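(* Let $\psi$ be a 3-CNF formula and let $F_\psi$ be the signed digraph constructed from it as described in the context. Then $\psi$ is not satisfiable if and only if every Boolean network on $F_\psi$ is synchronizing.
   Context: $\psi$ is a 3-CNF formula over variables $\lambda_1,\dots,\lambda_n$ ($n\ge 2$) with clauses $\mu_1,\dots,\mu_m$ ($m\ge1$). Each variable $\lambda_r$ has literals $\lambda_r^+,\lambda_r^-$; each clause is a set of three literals written $\mu_s=\{\mu_{s,1},\mu_{s,2},\mu_{s,3}\}$ in a fixed order. $z\in\{0,1\}^n$ satisfies $\lambda_r^+$ if $z_r=1$ and $\lambda_r^-$ if $z_r=0$; $\psi$ is satisfiable if some $z$ satisfies a literal in every clause. $H_\psi$ is the signed digraph with vertices: all literals $\lambda_r^\pm$, $\ell_0,\dots,\ell_n$, $\mu'_1,\dots,\mu'_m$, $\mu_1,\dots,\mu_m$, $c_1,\dots,c_m$; arcs, for $r\in[n]$, $s\in[m]$: $(\ell_{r-1},\lambda_r^\pm)$, $(\lambda_r^\pm,\ell_r)$, $(c_1,\ell_0)$, $(\mu_{s,1},\mu'_s),(\mu_{s,2},\mu'_s),(\mu_{s,3},\mu_s),(\mu'_s,\mu_s)$ (with $\mu_{s,k}$ the literal vertex), $(\mu_s,c_s)$, $(c_{s+1},c_s)$ with $c_{m+1}=\ell_n$; the arcs $(\mu_s,c_s)$ are negative, all others positive. $F_\psi$ is obtained from $H_\psi$ by: adding a vertex $t$ and a positive arc $(t,i)$ for each literal vertex $i$; making the arc $(c_1,\ell_0)$ negative; deleting each arc $(\mu_s,c_s)$;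 and adding, for each $s\in[m]$, new vertices $q_s,q'_s$ with positive arcs $(\mu_s,q'_s),(\mu_s,q_s),(q'_s,q_s),(q_s,c_s)$. A signed digraph is $(V,E)$ with $E\subseteq V\times V\times\{-1,1\}$. A Boolean network (BN) is $f:\{0,1\}^V\to\{0,1\}^V$; its signed interaction digraph has a positive (negative) arc from $j$ to $i$ iff for some $x$ with $x_j=0$, $f_i(x+e_j)-f_i(x)$ is positive (negative); a BN on $G$ is one whose signed interaction digraph is $G$. $f^i(x)$ is $x$ with $x_i$ replaced by $f_i(x)$; $f^{i_1\cdots i_\ell}=f^{i_\ell}\circ\cdots\circ f^{i_1}$; $f$ is synchronizing if $f^w$ is constant for some word $w$. *)

(* Defs.v *)
From HB Require Import structures.
From mathcomp Require Import all_boot.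
Set Implicit Arguments. Unset Strict Implicit. Unset Printing Implicit Defensive.

(* A literal over variables lambda_1..lambda_n is a pair (r, b) with r : 'I_n
   (0-based: r stands for lambda_{r+1}) and b = true for lambda^+,
   b = false for lambda^-. *)
Definition literal (n : nat) := ('I_n * bool)%type.

(* A 3-CNF formula with m clauses: clause s (0-based, for mu_{s+1}) lists its
   three literals mu_{s,1}, mu_{s,2}, mu_{s,3} in the fixed order k = 0,1,2. *)
Definition cnf3 (n m : nat) := 'I_m -> 'I_3 -> literal n.

(* each clause is a SET of three literals: its three literals are distinct *)
Definition wf_cnf3 n m (psi : cnf3 n m) : Prop := forall s, injective (psi s).

Definition sat_lit n (z : 'I_n -> bool) (l : literal n) : bool := z l.1 == l.2.

Definition satisfiable n m (psi : cnf3 n m) : Prop :=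
  exists z : 'I_n -> bool, forall s : 'I_m, exists k : 'I_3, sat_lit z (psi s k).

Inductive vtx (n m : nat) :=
| VLit of 'I_n & bool
| VL of 'I_n.+1
| VMu' of 'I_m
| VMu of 'I_m
| VC of 'I_m
| VT
| VQ of 'I_m
| VQ' of 'I_m.

Arguments VLit {n m} _ _. Arguments VL {n m} _. Arguments VMu' {n m} _.
Arguments VMu {n m} _. Arguments VC {n m} _. Arguments VT {n m}.
Arguments VQ {n m} _. Arguments VQ' {n m} _.

Section VtxFin.
Variables n m : nat.
Definition vtx_code := (('I_n * bool) + ('I_n.+1 + (('I_m * 'I_5) + unit)))%type.
Definition vtx_enc (v : vtx n m) : vtx_code :=
  match v with
  | VLit r b => inl (r, b)
  | VL k => inr (inl k)
  | VMu' s => inr (inr (inl (s, inord 0)))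
  | VMu s => inr (inr (inl (s, inord 1)))
  | VC s => inr (inr (inl (s, inord 2)))
  | VQ s => inr (inr (inl (s, inord 3)))
  | VQ' s => inr (inr (inl (s, inord 4)))
  | VT => inr (inr (inr tt))
  end.
Definition vtx_dec (c : vtx_code) : vtx n m :=
  match c with
  | inl (r, b) => VLit r b
  | inr (inl k) => VL k
  | inr (inr (inl (s, i))) =>
      match val i with
      | 0 => VMu' s | 1 => VMu s | 2 => VC s | 3 => VQ s | _ => VQ' s
      end
  | inr (inr (inr _)) => VT
  end.
Lemma vtx_encK : cancel vtx_enc vtx_dec.
Proof. by case=> //= s; rewrite inordK. Qed.
HB.instance Definition _ := Finite.copy (vtx n m) (can_type vtx_encK).
End VtxFin.


Definition lit_vtx n m (l : literal n) : vtx n m := VLit l.1 l.2.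

(* A signed digraph on a vertex type V: arc u v sg holds iff (u, v, sg) is an
   arc, where sg = true means sign +1 and sg = false means sign -1. *)
Definition signed_digraph (V : Type) := V -> V -> bool -> Prop.

Section Graphs.
Variables (n m : nat) (psi : cnf3 n m).
Local Notation V := (vtx n m).

Definition k1 : 'I_3 := @Ordinal 3 0 isT.
Definition k2 : 'I_3 := @Ordinal 3 1 isT.
Definition k3 : 'I_3 := @Ordinal 3 2 isT.

Definition is_c1_l0 (u v : V) : Prop :=
  exists s : 'I_m, val s = 0 /\ u = VC s /\ v = VL (@ord0 n).

Definition H_arc : signed_digraph V := fun u v sg =>
  (exists (r : 'I_n) (b : bool),
      u = VL (widen_ord (leqnSn n) r) /\ v = VLit r b /\ sg = true) \/
  (exists (r : 'I_n) (b : bool),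
      u = VLit r b /\ v = VL (lift ord0 r) /\ sg = true) \/
  (is_c1_l0 u v /\ sg = true) \/
  (exists s : 'I_m, u = lit_vtx m (psi s k1) /\ v = VMu' s /\ sg = true) \/
  (exists s : 'I_m, u = lit_vtx m (psi s k2) /\ v = VMu' s /\ sg = true) \/
  (exists s : 'I_m, u = lit_vtx m (psi s k3) /\ v = VMu s /\ sg = true) \/
  (exists s : 'I_m, u = VMu' s /\ v = VMu s /\ sg = true) \/
  (exists s : 'I_m, u = VMu s /\ v = VC s /\ sg = false) \/
  (exists s s' : 'I_m, val s' = (val s).+1 /\ u = VC s' /\ v = VC s /\ sg = true) \/
  (* (c_{m+1}, c_m) = (ell_n, c_m) positive *)
  (exists s : 'I_m, val s = m.-1 /\ u = VL (@ord_max n) /\ v = VC s /\ sg = true).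

Definition F_arc : signed_digraph V := fun u v sg =>
  (H_arc u v sg /\ ~ is_c1_l0 u v /\ ~ (exists s : 'I_m, u = VMu s /\ v = VC s)) \/
  (is_c1_l0 u v /\ sg = false) \/
  (exists (r : 'I_n) (b : bool), u = VT /\ v = VLit r b /\ sg = true) \/
  (exists s : 'I_m, u = VMu s /\ v = VQ' s /\ sg = true) \/
  (exists s : 'I_m, u = VMu s /\ v = VQ s /\ sg = true) \/
  (exists s : 'I_m, u = VQ' s /\ v = VQ s /\ sg = true) \/
  (exists s : 'I_m, u = VQ s /\ v = VC s /\ sg = true).
End Graphs.

Section BN.
Variable V : finType.
Definition config := {ffun V -> bool}.
Definition BN := config -> config.

Definition setc (x : config) (j : V) (b : bool) : config :=
  [ffun k => if k == j then b else x k].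

Definition interaction_arc (f : BN) : signed_digraph V := fun j i sg =>
  exists x : config, x j = false /\
    (if sg then (f x i == false) && (f (setc x j true) i == true)
           else (f x i == true) && (f (setc x j true) i == false)).

Definition BN_on (G : signed_digraph V) (f : BN) : Prop :=
  forall j i sg, interaction_arc f j i sg <-> G j i sg.

Definition upd (f : BN) (i : V) (x : config) : config := setc x i (f x i).

Definition upd_word (f : BN) (w : seq V) (x : config) : config :=
  foldl (fun y i => upd f i y) x w.

Definition synchronizing (f : BN) : Prop :=
  exists w : seq V, forall x y : config, upd_word f w x = upd_word f w y.
End BN.

(* Main.v *)
(* All cycles of F pass through ell_0, and every vertex but ell_0 and t computes
   an AND or an OR of its two inputs. Sweeping the vertices in topological order
   leaves only two states, indexed by the bit sent by ell_0; an active vertex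
   carries that bit, and the others are frozen. An AND or OR of two active inputs
   can be made equal in both states by stopping the sweep between the inputs; this
   synchronizes the network as soon as it happens to c_1. Otherwise, following
   backwards the vertices that cannot be equalized, each mu_s is frozen, hence has
   a frozen literal, and exactly one literal of each variable is frozen: this is a
   satisfying assignment. Conversely, a satisfying assignment gives a network in
   which one negative cycle copies its bit forever, everything it reads being 1. *)
Require Import Defs.
From HB Require Import structures.
From mathcomp Require Import all_boot zify.
From Stdlib Require Import Classical.
Set Implicit Arguments. Unset Strict Implicit. Unset Printing Implicit Defensive.

(** * AND/OR gates and their signed arcs *)

Definition gate (o a b : bool) : bool := if o then a && b else a || b.

Lemma gateC o : commutative (gate o).
Proof. by case: o => [] [] []. Qed.

(** Gates are monotone: fed with constants and copies of [b], they are constant or equal to [b]. *)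
Lemma gate_active o (p q : bool -> bool) b :
  (p true = p false \/ forall a, p a = a) ->
  (q true = q false \/ forall a, q a = a) ->
  gate o (p true) (q true) != gate o (p false) (q false) -> gate o (p b) (q b) = b.
Proof.
case=> Ep [] Eq; rewrite ?Ep ?Eq ?eqxx //; case: b; rewrite ?Ep ?Eq;
  by case: o; case: (p false); case: (q false).
Qed.

Section Arcs.
Variables (V : finType) (f : BN V).
Implicit Types (x y : config V) (i j p q : V).

Lemma interaction_arcE j i sg :
  interaction_arc f j i sg <->
  exists x, [/\ x j = false, f x i = ~~ sg & f (setc x j true) i = sg].
Proof.
case: sg; (split=> -[x]; [case=> xj /andP[/eqP ? /eqP ?]|case=> xj fx fy]);
  by exists x; split; rewrite // fx fy.
Qed.

Lemma updE x i k : upd f i x k = if k == i then f x i else x k.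
Proof. exact: ffunE. Qed.

Lemma setc_id x j : setc x j (x j) = x.
Proof. by apply/ffunP=> k; rewrite ffunE; case: eqP => // ->. Qed.

Lemma setc_setc x j a b : setc (setc x j a) j b = setc x j b.
Proof. by apply/ffunP=> k; rewrite !ffunE; case: eqP. Qed.

Lemma setc_no_arc i j x a :
  (forall sg, ~ interaction_arc f j i sg) -> f (setc x j a) i = f x i.
Proof.
move=> no; suff E y : f (setc y j true) i = f (setc y j false) i.
  by rewrite -[in RHS](setc_id x j); case: a (x j) => [] [].
case: (boolP (f (setc y j false) i == f (setc y j true) i)) => [/eqP-> //|ne].
case: (no (f (setc y j true) i)); apply/interaction_arcE.
exists (setc y j false); split; rewrite ?setc_setc ?ffunE ?eqxx //.
by case: (f _ _) (f _ _) ne => [] [].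
Qed.

Lemma eq_inputs i x y :
  (forall j sg, interaction_arc f j i sg -> x j = y j) -> f x i = f y i.
Proof.
move=> eqxy.
(* Coordinates are switched from [x] to [y] one at a time; [s] lists those already switched. *)
suff E (s : seq V) : f [ffun k => if k \in s then y k else x k] i = f x i.
  by rewrite -(E (enum V)); congr (f _ i); apply/ffunP=> k; rewrite ffunE mem_enum inE.
elim: s => [|j s <-].
  by congr (f _ i); apply/ffunP=> k; rewrite ffunE.
set z := [ffun k => if k \in s then y k else x k].
have -> : [ffun k => if k \in j :: s then y k else x k] = setc z j (y j).
  by apply/ffunP=> k; rewrite !ffunE inE; case: eqP => [->|].
case: (eqVneq (z j) (y j)) => [<-|ne]; first by rewrite setc_id.
apply: setc_no_arc => sg /eqxy xy; case/eqP: ne.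
by rewrite ffunE xy; case: ifP.
Qed.

Lemma const_of_arcs i :
  (forall j sg, ~ interaction_arc f j i sg) -> exists a, forall x, f x i = a.
Proof.
move=> no; exists (f [ffun => false] i) => x.
by apply: eq_inputs => j sg /no.
Qed.

Lemma arcs_of_const i a j sg :
  (forall x, f x i = a) -> ~ interaction_arc f j i sg.
Proof. by move=> fi /interaction_arcE[x []]; rewrite !fi => _ ->; case: sg. Qed.

(** Up to negation when [s] is false, [f] at [i] is monotone in [p] and [q] and depends on both; AND
    and OR are the only such functions of two distinct bits. *)
Lemma gate_of_arcs i p q s :
  (forall j sg, interaction_arc f j i sg <-> sg = s /\ (j = p \/ j = q)) ->
  exists o, forall x, f x i = (gate o (x p) (x q) == s).
Proof.
move=> arcs; pose c a b : config V := [ffun k => if k == p then a else (k == q) && b].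
have cE x : f x i = f (c (x p) (x q)) i.
  apply: eq_inputs => j sg /arcs[_ [] ->]; rewrite !ffunE eqxx //.
  by case: eqP => [->|].
have no j x : (j = p \/ j = q) -> x j = false ->
    ~ (f x i = s /\ f (setc x j true) i = ~~ s).
  move=> jpq xj [fx fy]; have: interaction_arc f j i (~~ s).
    by apply/interaction_arcE; exists x; rewrite negbK.
  by case/arcs; case: (s).
have /arcs/interaction_arcE[x [xp fxp fxp']] : s = s /\ (p = p \/ p = q) by auto.
have /arcs/interaction_arcE[y [yq fyq fyq']] : s = s /\ (q = p \/ q = q) by auto.
move: fxp fxp' fyq fyq'; rewrite cE xp (cE (setc x _ _)) !ffunE eqxx.
rewrite (cE y) yq (cE (setc y _ _)) !ffunE eqxx.
have nop b := no p (c false b) (or_introl erefl).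
have noq a := no q (c a false) (or_intror erefl).
case: (eqVneq q p) nop noq => [qp|qp] nop noq.
  (* With a single input both gates are the identity, so the choice of AND is arbitrary. *)
  subst q; rewrite xp => F T _ _; exists true => z; rewrite cE /= andbb.
  by case: (z p); rewrite ?F ?T; case: (s).
have setp b : setc (c false b) p true = c true b.
  by apply/ffunP=> k; rewrite !ffunE; case: eqP.
have setq a : setc (c a false) q true = c a true.
  apply/ffunP=> k; rewrite !ffunE; case: eqVneq => [->|]; last by rewrite andFb.
  by rewrite (negbTE qp).
have {}nop b : ~ (f (c false b) i = s /\ f (c true b) i = ~~ s).
  by rewrite -setp; apply: nop; rewrite ffunE eqxx.
have {}noq a : ~ (f (c a false) i = s /\ f (c a true) i = ~~ s).
  by rewrite -setq; apply: noq; rewrite ffunE eqxx (negbTE qp).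
move=> x1 x2 y1 y2.
suff [o oE] : exists o, forall a b, f (c a b) i = (gate o a b == s).
  by exists o => z; rewrite cE oE.
have {nop} := (nop false, nop true); have {noq} := (noq false, noq true).
case: (x q) (y p) x1 x2 y1 y2 => [] [];
  case E1: (f (c false false) i); case E2: (f (c false true) i);
  case E3: (f (c true false) i); case E4: (f (c true true) i);
  case: (s) => //= _ _ _ _ [n1 n2] [n3 n4];
  solve [ by exists true => [] [] []
        | by exists false => [] [] []
        | by case: n1 | by case: n2 | by case: n3 | by case: n4 ].
Qed.

Lemma arcs_of_gate i p q s o j sg :
  (forall x, f x i = (gate o (x p) (x q) == s)) ->
  interaction_arc f j i sg <-> sg = s /\ (j = p \/ j = q).
Proof.
move=> fi; split=> [/interaction_arcE[x [xj]]|[-> jpq]].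
  rewrite !fi !ffunE !(eq_sym _ j).
  case: (eqVneq j p) => [<-|_]; case: (eqVneq j q) => [<-|_]; rewrite ?xj.
  - by case: o s sg {fi} => [] [] [] //=; auto.
  - by case: o (x q) s sg {fi} => [] [] [] [] //=; auto.
  - by case: o (x p) s sg {fi} => [] [] [] [] //=; auto.
  - by move=> ->; case: sg.
(* [o] is the neutral value of the gate, so the output follows [j]. *)
apply/interaction_arcE; exists [ffun k => (k != j) && o].
rewrite !fi !ffunE eqxx; case: jpq => <-; rewrite eqxx /=.
  by case: (q == j); case: o {fi} s => [] [].
by case: (p == j); case: o {fi} s => [] [].
Qed.

End Arcs.

(** * Networks whose cycles all pass through one negating root *)

Section NegativeFeedback.
Variables (V : finType) (f : BN V) (root c : V) (rank : V -> nat).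
Hypothesis rank_root : rank root = 0.
Hypothesis f_root : forall x, f x root = ~~ x c.
Hypothesis f_gate : forall v, v != root -> (exists a, forall x, f x v = a) \/
  exists o p q, [/\ rank p < rank v, rank q < rank v &
                 forall x, f x v = gate o (x p) (x q)].
Implicit Types (x y : config V) (v p q : V) (w s : seq V) (b : bool).

Lemma upd_word_cat s w x : upd_word f (s ++ w) x = upd_word f w (upd_word f s x).
Proof. exact: foldl_cat. Qed.

Lemma eq_lower_rank x y v :
  v != root -> (forall p, rank p < rank v -> x p = y p) -> f x v = f y v.
Proof.
by case/f_gate=> [[a fE]|[o [p [q [pv qv fE]]]]] xy; rewrite !fE // !xy.
Qed.

Let N := (\max_v rank v).+1.

Lemma rank_ltN v : rank v < N.
Proof. by rewrite ltnS leq_bigmax. Qed.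

Let step b x : config V := [ffun v => if v == root then b else f x v].

(** With [root] held at [b], parallel updates beyond the largest rank forget the initial
    configuration and reach a fixed point. [locked] prevents unfolding. *)
Definition settled b := locked (iter N (step b) [ffun => false]).

Lemma iter_step b k x y v : rank v < k -> iter k (step b) x v = iter k (step b) y v.
Proof.
elim: k v => //= k IH v vk; rewrite !ffunE; case: eqVneq => // vr.
by apply: eq_lower_rank => // p pv; apply: IH; lia.
Qed.

Lemma step_settled b : step b (settled b) = settled b.
Proof.
apply/ffunP=> v; rewrite /settled -lock -iterS iterSr.
exact/iter_step/rank_ltN.
Qed.

Lemma settled_root b : settled b root = b.
Proof. by rewrite -step_settled ffunE eqxx. Qed.

Lemma settled_fix b v : v != root -> f (settled b) v = settled b v.
Proof. by move=> vr; rewrite -[in RHS]step_settled ffunE (negbTE vr). Qed.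

Fixpoint ranks_below k : seq V :=
  if k is k'.+1 then
    ranks_below k' ++ [seq v <- enum V | (rank v == k') && (v != root)]
  else [::].

(** Vertices of equal rank do not read each other, so their update order is irrelevant. *)
Lemma upd_level b k s y :
    {in s, forall v, rank v = k /\ v != root} ->
    (forall v, rank v < k -> y v = settled b v) ->
  forall v, upd_word f s y v = if v \in s then settled b v else y v.
Proof.
elim: s y => //= u s IH y sP yk v.
have [uk ur] := sP u (mem_head u s).
have fu : f y u = settled b u.
  by rewrite -settled_fix //; apply: eq_lower_rank => // p; rewrite uk; apply: yk.
rewrite IH; last 2 first.
- by move=> p ps; apply: sP; rewrite inE ps orbT.
- by move=> p pk; rewrite updE fu; case: eqP => [->|_] //; apply: yk.
by rewrite inE updE fu; case: (eqVneq v u) => [->|_]; case: (_ \in _).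
Qed.

Lemma upd_ranks_below b k y v : y root = b ->
  upd_word f (ranks_below k) y v =
  if (v == root) || (rank v < k) then settled b v else y v.
Proof.
move=> yr; elim: k v => [|k IH] v /=.
  by rewrite orbF; case: eqP => // ->; rewrite settled_root.
rewrite upd_word_cat (@upd_level b k).
- rewrite mem_filter mem_enum inE andbT IH ltnS [rank v <= k]leq_eqVlt.
  by case: (v == root); case: (rank v == k).
- by move=> u; rewrite mem_filter => /andP[/andP[/eqP]].
by move=> u uk; rewrite IH uk orbT.
Qed.

Definition sweep k := root :: ranks_below k.

(** A full sweep retains only the bit [y c]; one stopped at rank [k] mixes new values below with old
    values above. *)
Lemma upd_sweep k y v :
  upd_word f (sweep k) y v =
  if (v == root) || (rank v < k) then settled (~~ y c) v else y v.
Proof.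
rewrite /= (@upd_ranks_below (~~ y c)).
  by rewrite updE; case: (v == root).
by rewrite updE eqxx f_root.
Qed.

Lemma upd_full_sweep y : upd_word f (sweep N) y = settled (~~ y c).
Proof. by apply/ffunP=> v; rewrite upd_sweep rank_ltN orbT. Qed.

Definition frozen v := settled true v == settled false v.

Lemma settled_active b v : ~~ frozen v -> settled b v = b.
Proof.
rewrite /frozen; have [k] := ubnP (rank v).
elim: k v b => // k IH v b vk.
case: (eqVneq v root) => [-> _|vr]; first by rewrite settled_root.
rewrite -!settled_fix //.
case: (f_gate vr) => [[a fE]|[o [p [q [pv qv fE]]]]]; first by rewrite !fE eqxx.
have {}IH u : rank u < rank v ->
    settled true u = settled false u \/ (forall a, settled a u = a).
  move=> uv; case: (eqVneq (settled true u) (settled false u)) => [|ne]; first by left.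
  by right=> a; apply: IH => //; lia.
by rewrite !fE; apply: (gate_active (p := settled^~ p) (q := settled^~ q)) => //; apply: IH.
Qed.

(** Agreement on frozen vertices is invariant under updates. A frozen gate cannot have two active
    inputs, and if it has one, its frozen input is absorbing (0 for AND, 1 for OR), whatever the
    active one holds. *)
Lemma frozen_upd w b v : frozen v -> upd_word f w (settled b) v = settled true v.
Proof.
have : forall u, frozen u -> settled b u = settled true u.
  by move=> u /eqP; case: b.
elim: w (settled b) v => [|u w IH] y v yE /=; first exact: yE.
apply: IH => {w}{}v frv; rewrite updE; case: eqP => [<-{u}|_]; last exact: yE.
have vr : v != root.
  by apply: contraTneq frv => ->; rewrite /frozen !settled_root.
rewrite -settled_fix //.
case: (f_gate vr) => [[a fE]|[o [p [q [_ _ fE]]]]]; rewrite !fE //.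
move: frv; rewrite /frozen -!(settled_fix _ vr) !fE.
case: (boolP (frozen p)) => frp; case: (boolP (frozen q)) => frq.
- by rewrite (yE p frp) (yE q frq).
- rewrite (yE p frp) -(eqP frp) !(settled_active _ frq).
  by case: o (settled true p) (y q) {fE} => [] [] [].
- rewrite (yE q frq) -(eqP frq) !(settled_active _ frp).
  by case: o (settled true q) (y p) {fE} => [] [] [].
by rewrite !(settled_active _ frp) !(settled_active _ frq); case: (o).
Qed.

Definition mergeable v :=
  exists w, upd_word f w (settled true) v = upd_word f w (settled false) v.

Lemma frozen_mergeable v : frozen v -> mergeable v.
Proof. by move=> frv; exists [::]; apply/eqP. Qed.

(** The first sweep leaves at most two configurations, [w] equalizes [c] in them, and the last sweep
    reads nothing but [c]. *)
Lemma mergeable_sync : mergeable c -> synchronizing f.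
Proof.
case=> w wE; exists (sweep N ++ w ++ sweep N) => x y.
rewrite !upd_word_cat !upd_full_sweep; congr (settled (~~ _)).
by case: (x c) (y c) => [] []; rewrite //= wE.
Qed.

Lemma upd_word_rcons w v x :
  upd_word f (rcons w v) x = upd f v (upd_word f w x).
Proof. by rewrite -cats1 upd_word_cat. Qed.

Lemma mergeable_copy v p :
  (forall x, f x v = x p) -> mergeable p -> mergeable v.
Proof.
move=> fE [w wE]; exists (rcons w v).
by rewrite !upd_word_rcons !updE eqxx !fE.
Qed.

Lemma mergeable_frozen_input o v p q : (forall x, f x v = gate o (x p) (x q)) ->
  mergeable p -> frozen q -> mergeable v.
Proof.
move=> fE [w wE] frq; exists (rcons w v).
by rewrite !upd_word_rcons !updE eqxx !fE wE !(frozen_upd _ _ frq).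
Qed.

(* Sweeping only up to the first of the two active inputs leaves them with
   opposite values, and the gate outputs the same bit from both states. *)
Lemma mergeable_active_inputs o v p q : ~~ frozen c ->
  (forall x, f x v = gate o (x p) (x q)) -> rank p < rank q ->
  ~~ frozen p -> ~~ frozen q -> mergeable v.
Proof.
move=> ac fE pq ap aq; exists (rcons (sweep (rank q)) v).
rewrite !upd_word_rcons !updE eqxx !fE !upd_sweep pq orbT ltnn orbF.
have -> : q == root = false by apply: contraTF pq => /eqP->; rewrite rank_root.
by rewrite !settled_active //; case: (o).
Qed.

(** The step of the backward search. Two active inputs of distinct ranks, or a mergeable input
    beside a frozen one, would make [v] mergeable. *)
Lemma not_mergeable_gate o v p q : ~ mergeable c -> ~ mergeable v ->
  (forall x, f x v = gate o (x p) (x q)) -> rank p != rank q ->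
  (~ mergeable p /\ frozen q) \/ (~ mergeable q /\ frozen p).
Proof.
move=> nc nv fE pq.
have ac : ~~ frozen c by apply/negP=> /frozen_mergeable.
have fE' x : f x v = gate o (x q) (x p) by rewrite fE gateC.
case: (boolP (frozen p)) => [frp|ap].
  by right; split=> // mq; apply: nv; apply: mergeable_frozen_input frp; first exact: fE'.
case: (boolP (frozen q)) => [frq|aq].
  by left; split=> // mp; apply: nv; apply: mergeable_frozen_input frq; first exact: fE.
case: nv; case: (ltngtP (rank p) (rank q)) pq => // [pq|qp] _.
  exact: mergeable_active_inputs fE pq ap aq.
exact: mergeable_active_inputs fE' qp aq ap.
Qed.

(** Two active inputs both carry the root's bit, and so would their gate. *)
Lemma frozen_gate o v p q : v != root -> (forall x, f x v = gate o (x p) (x q)) ->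
  frozen v -> frozen p || frozen q.
Proof.
move=> vr fE frv; apply: contraLR frv; rewrite negb_or => /andP[ap aq].
by rewrite /frozen -!(settled_fix _ vr) !fE !settled_active //; case: (o).
Qed.

Lemma frozen_const v a : v != root -> (forall x, f x v = a) -> frozen v.
Proof. by move=> vr fE; rewrite /frozen -!(settled_fix _ vr) !fE. Qed.

End NegativeFeedback.

(** * The digraph $F_\psi$ as a table of inputs *)

Section Construction.
Variables (n m : nat) (m_gt0 : 0 < m) (psi : cnf3 n m).
Local Notation V := (vtx n m).
Implicit Types (u v : V).

Local Notation root := (VL ord0 : V).

Definition c_first : V := VC (Ordinal m_gt0).

(** [insub] fails exactly at the last clause, which encodes $c_{m+1}=\ell_n$. *)
Definition c_next (s : 'I_m) : V :=
  if insub s.+1 is Some s' then VC s' else VL ord_max.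

(* The two in-neighbours of a vertex, repeated when there is only one;
   junk at [VT], which has none. *)
Definition inputs v : V * V :=
  match v with
  | VLit r b => (VT, VL (widen_ord (leqnSn n) r))
  | VL k => if unlift ord0 k is Some r then (VLit r true, VLit r false)
            else (c_first, c_first)
  | VMu' s => (lit_vtx m (psi s k1), lit_vtx m (psi s k2))
  | VMu s => (lit_vtx m (psi s k3), VMu' s)
  | VC s => (VQ s, c_next s)
  | VT => (VT, VT)
  | VQ s => (VMu s, VQ' s)
  | VQ' s => (VMu s, VMu s)
  end.

Lemma VL_root r : (VL (lift ord0 r) == root) = false.
Proof. by apply/eqP=> -[]. Qed.

Lemma c_nextP (s : 'I_m) u :
  (exists s' : 'I_m, val s' = s.+1 /\ u = VC s') \/ (val s = m.-1 /\ u = VL ord_max)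
  <-> u = c_next s.
Proof.
rewrite /c_next; case: insubP => [s' _ s'E|].
  split=> [[[t [tE ->]]|[sE _]]|->]; last by left; exists s'.
    by congr VC; apply: val_inj; rewrite tE s'E.
  by have := ltn_ord s'; move: s'E sE => /= -> ->; lia.
move=> ms; have sm := ltn_ord s.
split=> [[[t [tE _]]|[_ ->]]|->] //; last by right; split=> //=; lia.
by have := ltn_ord t; move: tE => /= ->; lia.
Qed.

(** The normal form required by [gate_of_arcs]: all arcs entering a vertex share one sign, negative
    only at $\ell_0$. *)
Lemma F_arcE u v sg : F_arc psi u v sg <->
  v != VT /\ sg = (v != root) /\ (u = (inputs v).1 \/ u = (inputs v).2).
Proof.
split.
  have last2 (w : V) s : w = c_next s -> VC s != VT /\ true = (VC s != root) /\
      (w = (inputs (VC s)).1 \/ w = (inputs (VC s)).2) by move=> ->; auto.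
  case=> [[H [n1 n2]]|H].
    case: H => [[r [b [-> [-> ->]]]]|H]; first by auto.
    case: H => [[r [b [-> [-> ->]]]]|H].
      by rewrite VL_root /= liftK; case: b; auto.
    case: H => [[H _]|H]; first by case: (n1 H).
    case: H => [[s [-> [-> ->]]]|H]; first by auto.
    case: H => [[s [-> [-> ->]]]|H]; first by auto.
    case: H => [[s [-> [-> ->]]]|H]; first by auto.
    case: H => [[s [-> [-> ->]]]|H]; first by auto.
    case: H => [[s [uE [vE _]]]|H]; first by case: n2; exists s.
    case: H => [[s [s' [sE [-> [-> ->]]]]]|[s [sE [-> [-> ->]]]]].
      by apply: last2; apply/c_nextP; left; exists s'.
    by apply: last2; apply/c_nextP; right.
  case: H => [[[s [s0 [-> ->]]] ->]|H].
    rewrite eqxx /= unlift_none; split=> //; split=> //; left.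
    by congr VC; apply: val_inj.
  case: H => [[r [b [-> [-> ->]]]]|H]; first by auto.
  case: H => [[s [-> [-> ->]]]|H]; first by auto.
  case: H => [[s [-> [-> ->]]]|H]; first by auto.
  case: H => [[s [-> [-> ->]]]|H]; first by auto.
  by case: H => [s [-> [-> ->]]]; auto.
case=> vT [-> uE].
(* Arcs of $H_\psi$ that are neither re-signed nor deleted. *)
have Hcase w x : H_arc psi w x true -> (forall s, x <> VC s \/ forall t, w <> VMu t) -> x <> root ->
    F_arc psi w x true.
  move=> H no xr; left; split=> //; split=> [[s [_ [_ /xr]]]|[s [wE xE]]] //.
  by case: (no s) => // /(_ s).
case: v vT uE => [r b|k|s|s|s||s|s] //= _.
- case=> ->; first by right; right; left; exists r, b.
  by apply: Hcase => //; [left; exists r, b|left].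
- case: unliftP => [r ->|->].
    rewrite VL_root => uE; apply: Hcase => //.
      by right; left; case: uE => ->; [exists r, true|exists r, false].
    by left.
  rewrite eqxx => uE; right; left; split=> //; exists (Ordinal m_gt0).
  by case: uE => ->.
- case=> ->; apply: Hcase => //; try by left.
    by do 3 right; left; exists s.
  by do 4 right; left; exists s.
- case=> ->; apply: Hcase => //; try by left.
    by do 5 right; left; exists s.
  by do 6 right; left; exists s.
- case=> [->|uE]; first by do 6 right; exists s.
  apply: Hcase => //.
    case/c_nextP: uE => [[s' [sE ->]]|[sE ->]].
      by do 8 right; left; exists s, s'.
    by do 9 right; exists s.
  by right=> t; rewrite uE /c_next; case: insubP.
- by case=> ->; [do 4 right; left; exists s|do 5 right; left; exists s].
- by case=> ->; do 3 right; left; exists s.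
Qed.

Lemma F_BNP f : BN_on (F_arc psi) f <->
  (exists a, forall x, f x VT = a) /\
  (forall v, v != VT -> exists o, forall x,
     f x v = (gate o (x (inputs v).1) (x (inputs v).2) == (v != root))).
Proof.
split=> [fF|[[a fT] fG] j i sg].
  split=> [|v vT].
    by apply: const_of_arcs => j sg /fF/F_arcE[/eqP].
  apply: gate_of_arcs => j sg; rewrite fF F_arcE vT.
  by split=> [[]|].
rewrite F_arcE; case: (eqVneq i VT) => [->|iT].
  by split=> [/(arcs_of_const fT)|[]].
have [o /arcs_of_gate ->] := fG i iT.
by split=> [|[]].
Qed.

(* Besides increasing along the arcs that do not enter [VL ord0], the rank must
   separate the two inputs of [VL (lift ord0 r)], [VQ s] and [VC s], for
   [mergeable_active_inputs] to apply there. *)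
Definition vrank v : nat :=
  match v with
  | VLit r b => (3 * r).+1 + b
  | VL k => 3 * k
  | VMu' s => (3 * n).+1
  | VMu s => (3 * n).+2
  | VC s => (3 * n).+4 + (m - s).+1
  | VT => 0
  | VQ s => (3 * n).+4
  | VQ' s => (3 * n).+3
  end.

Lemma vrank_lit (l : literal n) : vrank (lit_vtx m l) <= 3 * n.
Proof. by case: l => r b /=; have := ltn_ord r; case: b; lia. Qed.

Lemma vrank_next s : vrank (c_next s) < vrank (VC s).
Proof.
rewrite /c_next; case: insubP => [s' _ /= s'E|_] /=; last by lia.
by have := ltn_ord s'; lia.
Qed.

Lemma vrank_inputs v : v != VT -> v != root ->
  vrank (inputs v).1 < vrank v /\ vrank (inputs v).2 < vrank v.
Proof.
case: v => [r b|k|s|s|s||s|s] // _.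
- by move=> _ /=; lia.
- case: (unliftP ord0 k) => [r ->|->]; last by rewrite eqxx.
  by move=> _; rewrite /inputs liftK /= /bump /=; lia.
- by move=> _; split; apply: leq_ltn_trans (vrank_lit _) _.
- by move=> _; split=> //=; apply: leq_ltn_trans (vrank_lit _) _; lia.
- by move=> _; split; [rewrite /=; lia|apply: vrank_next].
Qed.

(** * From a network that cannot merge $c_1$ to a satisfying assignment *)

Section Unsynchronized.
Variable f : BN V.
Hypothesis f_F : BN_on (F_arc psi) f.

Local Notation mergeable := (mergeable f root vrank).
Local Notation frozen := (frozen f root vrank).

Lemma F_root x : f x root = ~~ x c_first.
Proof.
have [_ /(_ root isT)[o ->]] := (F_BNP f).1 f_F.
by rewrite eqxx /= unlift_none; case: o (x _) => [] [].
Qed.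

Lemma F_gate v : v != VT -> v != root ->
  exists o, forall x, f x v = gate o (x (inputs v).1) (x (inputs v).2).
Proof.
move=> vT vr; have [_ /(_ v vT)[o fE]] := (F_BNP f).1 f_F.
by exists o => x; rewrite fE vr eqb_id.
Qed.

Lemma F_ranked v : v != root -> (exists a, forall x, f x v = a) \/
  exists o p q, [/\ vrank p < vrank v, vrank q < vrank v &
                 forall x, f x v = gate o (x p) (x q)].
Proof.
move=> vr; case: (eqVneq v VT) => [->|vT]; first by left; case: ((F_BNP f).1 f_F).
have [o fE] := F_gate vT vr; have [p_v q_v] := vrank_inputs vT vr.
by right; exists o, (inputs v).1, (inputs v).2.
Qed.

Hypothesis c_first_split : ~ mergeable c_first.

Lemma split_inputs v : v != VT -> v != root ->
  vrank (inputs v).1 != vrank (inputs v).2 -> ~ mergeable v ->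
  (~ mergeable (inputs v).1 /\ frozen (inputs v).2) \/
  (~ mergeable (inputs v).2 /\ frozen (inputs v).1).
Proof.
move=> vT vr ne nv; have [o fE] := F_gate vT vr.
exact: (not_mergeable_gate (erefl : vrank root = 0) F_root F_ranked c_first_split nv fE ne).
Qed.

Lemma frozen_inputs v : v != VT -> v != root ->
  frozen v -> frozen (inputs v).1 || frozen (inputs v).2.
Proof.
move=> vT vr; have [o fE] := F_gate vT vr.
exact: (frozen_gate (erefl : vrank root = 0) F_ranked vr fE).
Qed.

Lemma frozen_VT : frozen VT.
Proof.
have [[a fT] _] := (F_BNP f).1 f_F.
exact: (frozen_const (v := VT) (erefl : vrank root = 0) F_ranked isT fT).
Qed.

(** This is the purpose of $q'_s$: it copies $\mu_s$ one rank later, so $q_s$ never has one frozen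
    input and one that is not mergeable. *)
Lemma mergeable_VQ s : mergeable (VQ s).
Proof.
apply: NNPP => nq.
have ne : vrank (VMu s) != vrank (VQ' s) by rewrite /=; lia.
have [[nmu fq']|[nq' fmu]] := @split_inputs (VQ s) isT isT ne nq.
  by apply/nmu/frozen_mergeable; have := @frozen_inputs (VQ' s) isT isT fq'; rewrite orbb.
have [o fE] := @F_gate (VQ' s) isT isT.
apply: nq'; apply: (@mergeable_copy _ _ _ _ _ (VMu s)); last exact: frozen_mergeable.
by move=> x; rewrite fE /=; case: o {fE} (x _) => [] [].
Qed.

Lemma split_VC s : ~ mergeable (VC s) -> ~ mergeable (c_next s) /\ frozen (VQ s).
Proof.
have ne : vrank (VQ s) != vrank (c_next s).
  by rewrite /c_next; case: insubP => [t _ _|_] /=; lia.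
move=> /(@split_inputs (VC s) isT isT ne)[[nq _]|//].
by case: nq; apply: mergeable_VQ.
Qed.

(** Since $q_s$ is mergeable, the obstruction at $c_s$ passes to $c_{s+1}$; it starts at $c_1$. *)
Lemma not_mergeable_VC s : ~ mergeable (VC s).
Proof.
case: s => k; elim: k => [|k IH] km; first by rewrite (bool_irrelevance km m_gt0).
have [+ _] := split_VC (IH (ltnW km)).
by have [+ _] := c_nextP (Ordinal (ltnW km)) (VC (Ordinal km)) => <- //; left; exists (Ordinal km).
Qed.

Lemma frozen_VMu s : frozen (VMu s).
Proof.
have [_ /(@frozen_inputs (VQ s) isT isT)/orP[//|]] := split_VC (@not_mergeable_VC s).
by move=> /(@frozen_inputs (VQ' s) isT isT); rewrite orbb.
Qed.

(** Each frozen gate has a frozen input: from $\mu_s$ this leads to its third literal, or through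
    $\mu'_s$ to one of the first two. *)
Lemma frozen_clause s : exists k, frozen (lit_vtx m (psi s k)).
Proof.
have /orP[fr|] := @frozen_inputs (VMu s) isT isT (frozen_VMu s); first by exists k3.
by move=> /(@frozen_inputs (VMu' s) isT isT)/orP[]; [exists k1|exists k2].
Qed.

Lemma split_lits r : ~ mergeable (VL (lift ord0 r)) ->
  exists b, ~ mergeable (VLit r b) /\ frozen (VLit r (~~ b)).
Proof.
have vr : VL (lift ord0 r) != root by rewrite VL_root.
move=> nr; have := split_inputs (v := VL (lift ord0 r)) isT vr _ nr.
rewrite /inputs liftK => -[|[]|[]]; [|by exists true|by exists false].
by rewrite /=; lia.
Qed.

(** The other input $t$ is constant, hence frozen, so a merging word for $\ell_{r-1}$ extends to the
    literal. *)
Lemma split_VLit r b : ~ mergeable (VLit r b) ->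
  ~ mergeable (VL (widen_ord (leqnSn n) r)).
Proof.
apply: contra_not => mr; have [o fE] := @F_gate (VLit r b) isT isT.
have fE' x : f x (VLit r b) = gate o (x (VL (widen_ord (leqnSn n) r))) (x VT).
  by rewrite fE gateC.
exact: (mergeable_frozen_input (erefl : vrank root = 0) F_ranked fE' mr frozen_VT).
Qed.

(** Downward induction through [d = n - k]: $\ell_n$ follows $c_m$, and each later $\ell$ leads back
    through one of its literals. *)
Lemma not_mergeable_VL k : ~ mergeable (VL k).
Proof.
have := ltn_ord k; rewrite ltnS; move: {2}(n - k) (erefl (n - k)) => d.
elim: d k => [|d IH] k dE kn.
  have pm : m.-1 < m by rewrite prednK.
  have [+ _] := split_VC (@not_mergeable_VC (Ordinal pm)).
  have [+ _] := c_nextP (Ordinal pm) (VL ord_max) => <-; last by right.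
  by have -> : k = ord_max by apply: val_inj => /=; lia.
have kn' : k < n by lia.
have := IH (lift ord0 (Ordinal kn')); rewrite /= /bump /= => {}IH.
have [|b [+ _]] := @split_lits (Ordinal kn'); first by apply: IH; lia.
move/split_VLit; congr (~ mergeable (VL _)); exact: val_inj.
Qed.

Lemma unsynchronized_sat : satisfiable psi.
Proof.
exists (fun r => frozen (VLit r true)) => s.
have [k frk] := frozen_clause s; exists k; rewrite /sat_lit.
move: (psi s k) frk => [r b] /= frb; apply/eqP.
(* Exactly one literal of each variable is frozen, the opposite one being not mergeable; hence a
   frozen literal is true. *)
have [b' [nb' frb']] := split_lits (@not_mergeable_VL (lift ord0 r)).
have {}nb' : ~~ frozen (VLit r b') by apply/negP=> /frozen_mergeable.
by case: b b' nb' frb frb' => [] [] //= /negbTE -> .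
Qed.

End Unsynchronized.

(** * From a satisfying assignment to a network that is not synchronizing *)

Section Satisfied.
Variable z : 'I_n -> bool.
Hypothesis z_sat : forall s, exists k, sat_lit z (psi s k).

(** For each variable, the cycle goes through the literal that [z] makes false. *)
Definition on_cycle v : bool :=
  match v with VLit r b => z r != b | VL _ | VC _ => true | _ => false end.

Definition held v : bool :=
  match v with
  | VLit r b => z r == b
  | VMu' s => sat_lit z (psi s k1) || sat_lit z (psi s k2)
  | VL _ | VC _ => false
  | _ => true
  end.

(* The vertices [on_cycle] are conjunctions, all others disjunctions, so that
   fixing the vertices [held] at 1 makes the former copy each other along a
   negative cycle. *)
Definition sat_BN : BN V := fun x =>
  [ffun v => if v == VT then true else
             gate (on_cycle v) (x (inputs v).1) (x (inputs v).2) == (v != root)].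

Lemma sat_BN_F : BN_on (F_arc psi) sat_BN.
Proof.
apply/F_BNP; split=> [|v vT]; first by exists true => x; rewrite ffunE.
by exists (on_cycle v) => x; rewrite ffunE (negbTE vT).
Qed.

(** Apart from the constant $t$, a held vertex is a disjunction with a held input; for $\mu_s$ that
    input comes from [z_sat]. *)
Lemma sat_BN_held (x : config V) v :
  (forall u, held u -> x u) -> held v -> sat_BN x v.
Proof.
move=> xh; rewrite ffunE; case: v => [r b|k|s|s|s||s|s] //=.
- by move=> zr; rewrite zr (xh VT).
- by case/orP=> [h1|h2]; rewrite ?(xh (lit_vtx m (psi s k1)) h1)
    ?(xh (lit_vtx m (psi s k2)) h2) ?orbT.
- move=> _; have [k] := z_sat s.
  have [->|[->|->]] : k = k1 \/ k = k2 \/ k = k3.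
    by case: k => -[|[|[|//]]] ?; [left|right; left|right; right]; apply: val_inj.
  + by move=> zk; rewrite (xh (VMu' s)) ?orbT //= zk.
  + by move=> zk; rewrite (xh (VMu' s)) ?orbT //= zk orbT.
  + by move=> zk; rewrite (xh (lit_vtx m (psi s k3)) zk).
- by rewrite (xh (VMu s)).
- by rewrite (xh (VMu s)).
Qed.

(** A cycle vertex other than $\ell_0$ is a conjunction of a held input and a cycle input, so it
    copies the latter; $\ell_0$ negates $c_1$. *)
Lemma sat_BN_cycle (x y : config V) v :
    (forall u, held u -> x u /\ y u) -> (forall u, on_cycle u -> y u = ~~ x u) ->
  on_cycle v -> sat_BN y v = ~~ sat_BN x v.
Proof.
move=> h xy; rewrite !ffunE; case: v => [r b|k|s|s|s||s|s] //.
- rewrite /inputs /on_cycle => -> /=; have [-> ->] := h VT isT.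
  by rewrite xy //=; case: (x _).
- move=> _; case: (unliftP ord0 k) => [r ->|->].
    rewrite /inputs liftK VL_root /=.
    have [xb yb] : x (VLit r (z r)) /\ y (VLit r (z r)) by apply: h => /=.
    have xyb : y (VLit r (~~ z r)) = ~~ x (VLit r (~~ z r)).
      by apply: xy => /=; case: (z r).
    by case: (z r) xb yb xyb => /= -> -> ->; case: (x _).
  by rewrite /inputs unlift_none eqxx /= xy //; case: (x _).
move=> _ /=; have [-> ->] := h (VQ s) isT; rewrite xy; first by case: (x _).
by rewrite /c_next; case: insubP.
Qed.

Lemma sat_BN_not_sync : ~ synchronizing sat_BN.
Proof.
case=> w sync; pose x : config V := [ffun => true].
pose y : config V := [ffun v => ~~ on_cycle v].
have xh v : held v -> x v /\ y v.
  by rewrite !ffunE; case: v => //= r b /eqP ->; rewrite eqxx.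
have xy v : on_cycle v -> y v = ~~ x v by rewrite !ffunE => ->.
(* Invariant of every update: held vertices are 1 in both configurations, and cycle vertices are
   opposite, so [root] always differs. *)
move: (sync x y) xh xy; move: x y {sync}.
elim: w => [|u w IH] x y /=.
  by move=> -> _ /(_ root isT); case: (y _).
move=> e h xy; apply: (IH _ _ e) => v; rewrite !updE; case: (eqVneq v u) => [<-|_].
- by move=> hv; split; apply: sat_BN_held hv => p /h[].
- exact: h.
- exact: sat_BN_cycle.
- exact: xy.
Qed.

End Satisfied.

End Construction.

Theorem theorem7 (n m : nat) (hn : 2 <= n) (hm : 1 <= m)
    (psi : cnf3 n m) (hpsi : wf_cnf3 psi) :
  ~ satisfiable psi <->
  (forall f : BN (vtx n m), BN_on (F_arc psi) f -> synchronizing f).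
Proof.
split=> [unsat f fF|sync [z z_sat]].
  apply: (mergeable_sync (erefl : vrank (VL ord0 : vtx n m) = 0)
           (F_root hm fF) (F_ranked hm fF)).
  by apply: NNPP => nc; apply: unsat; apply: unsynchronized_sat fF nc.
exact: (sat_BN_not_sync z_sat (sync _ (sat_BN_F hm psi z))).
Qed.
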